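(* For all integers $n\geq 1$ and $0\leq j\leq n$, we have $|B_n^j(1234)|=|B_n^j(2143)|$.
   Context: The signed permutation group $B_n$ consists of the permutations $w$ of $\{-n,\ldots,-1,1,\ldots,n\}$ such that $w(-i)=-w(i)$ for all $i$. Identify $w$ with a permutation in $S_{2n}$ by listing $w(-n),w(-n+1),\ldots,w(-1),w(1),\ldots,w(n)$ and standardizing values (the natural order on $\{-n,\ldots,-1,1,\ldots,n\}$). We say $w\in B_n$ avoids a pattern $\pi\in S_k$ if this associated permutation in $S_{2n}$ avoids $\pi$ in the classical sense. Concretely, $w$ avoids $1234$ iff there are no $-n\leq a<b<c<d\leq n$ (indices nonzero) with $w(a)<w(b)<w(c)<w(d)$, and $w$ avoids $2143$ iff there are no such $a<b<c<d$ with $w(b)<w(a)<w(d)<w(c)$. Let $B_n(\pi)$ be the set of $w\in B_n$ avoiding $\pi$, and for $0\le j\le n$ let $B_n^j(\pi)$ be the set of $w\in B_n(\pi)$ such that $w(i)>0$ for exactly $j$ indices $i\in\{1,\ldots,n\}$. *)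

(* Defs.v *)
From mathcomp Require Import all_boot all_fingroup.
Set Implicit Arguments. Unset Strict Implicit. Unset Printing Implicit Defensive.

(* Signed permutations of {-n..-1,1..n} encoded as permutations s of 'I_(2n):
   position/value p < n encodes the signed integer p - n (i.e. -n..-1),
   position/value p >= n encodes p - n + 1 (i.e. 1..n).  This encoding is
   order preserving, so s is exactly the standardization of the word
   w(-n),...,w(-1),w(1),...,w(n).  Negation corresponds to rev_ord. *)

Definition signed_perm (n : nat) (s : {perm 'I_(n + n)}) : bool :=
  [forall p, s (rev_ord p) == rev_ord (s p)].

Definition contains1234 (m : nat) (s : {perm 'I_m}) : bool :=
  [exists a : 'I_m, exists b : 'I_m, exists c : 'I_m, exists d : 'I_m,
    [&& a < b, b < c, c < d, s a < s b, s b < s c & s c < s d]].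

Definition contains2143 (m : nat) (s : {perm 'I_m}) : bool :=
  [exists a : 'I_m, exists b : 'I_m, exists c : 'I_m, exists d : 'I_m,
    [&& a < b, b < c, c < d, s b < s a, s a < s d & s d < s c]].

(* number of i in {1..n} with w(i) > 0 *)
Definition npos (n : nat) (s : {perm 'I_(n + n)}) : nat :=
  #|[set p : 'I_(n + n) | (n <= p) && (n <= s p)]|.

Definition Bnj1234 (n j : nat) : {set {perm 'I_(n + n)}} :=
  [set s | [&& signed_perm s, ~~ contains1234 s & npos s == j]].

Definition Bnj2143 (n j : nat) : {set {perm 'I_(n + n)}} :=
  [set s | [&& signed_perm s, ~~ contains2143 s & npos s == j]].

(* Main.v *)
(** The positive entries at positive positions of an avoider are decreasing (for 1234) or
    increasing (for 2143), because their negatives would otherwise complete a pattern. Hence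
    an avoider is determined by its quadrant of positive positions and negative values, a
    partial permutation P with j empty rows and j empty columns, and avoidance becomes
    avoidance in P of a four-term pattern whose leftmost term may be replaced by an empty
    row and whose topmost term may be replaced by an empty column.

    As in the shape-Wilf equivalence of 12 and 21, the relative order of the two lower terms
    is irrelevant: call a cell white if it has an occurrence of the two upper terms to its
    north-east. The non-white points, the white cells and the set of occupied columns
    form a skeleton, and every skeleton is realized by exactly one avoider, for either
    order. Reflection in the antidiagonal exchanges the lower and the upper pair, so both
    pairs of 1234 can be turned over one after the other. *)

Require Import Defs.
From mathcomp Require Import all_boot all_fingroup zify.
Set Implicit Arguments. Unset Strict Implicit. Unset Printing Implicit Defensive.

(** * Partial permutations and their skeletons *)

Section Cells.
Variable n : nat.
Notation cell := ('I_n * 'I_n)%type.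
Implicit Types (P Q : {set cell}) (x y z : cell) (c r : 'I_n) (R S : rel 'I_n).

(* A cell is a pair (column, row). *)
Definition partial_perm P :=
  [forall x in P, forall y in P, (x.1 == y.1) || (x.2 == y.2) ==> (x == y)].

Definition row_left P c r := [forall c', ((c', r) \in P) ==> (c' < c)].
Definition col_above P c r := [forall r', ((c, r') \in P) ==> (r < r')].

(* [x] is the second term of the pattern from the left and [y] the second from the top;
   [r] is the row of the leftmost term, which is occupied to the left of [x] or empty, and
   [c] the column of the topmost term, which is occupied above [y] or empty. [R] and [S]
   fix the order within the two pairs. *)
Definition occurs R S P :=
  [exists x in P, exists y in P, exists r : 'I_n, exists c : 'I_n,
    [&& x.1 < y.1, x.1 < c, x.2 < y.2, r < y.2,
        row_left P x.1 r, col_above P c y.2, R x.2 r & S y.1 c]].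

Definition white S P : {set cell} :=
  [set x : cell | [exists y in P, exists c : 'I_n,
    [&& x.1 < y.1, x.1 < c, x.2 < y.2, col_above P c y.2 & S y.1 c]]].

Definition columns P : {set 'I_n} := [set x.1 | x in P].

Definition swap_rows r r' P : {set cell} := [set x : cell | (x.1, tperm r r' x.2) \in P].

Definition avoiders R S k : {set {set cell}} :=
  [set P | [&& partial_perm P, ~~ occurs R S P & #|P| == k]].

Lemma partial_permP P : reflect
  (forall x y, x \in P -> y \in P -> x.1 = y.1 \/ x.2 = y.2 -> x = y)
  (partial_perm P).
Proof.
apply: (iffP forall_inP) => [H x y Px Py E|H x Px].
  apply/eqP/(implyP (forall_inP (H x Px) y Py)).
  by case: E => ->; rewrite eqxx ?orbT.
apply/forall_inP => y Py; apply/implyP => E; apply/eqP/H => //.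
by case/orP: E => /eqP; [left|right].
Qed.

Lemma row_leftP P c r :
  reflect (forall c', (c', r) \in P -> c' < c) (row_left P c r).
Proof. by apply: (iffP forallP) => H c'; apply/implyP/H. Qed.

Lemma col_aboveP P c r :
  reflect (forall r', (c, r') \in P -> r < r') (col_above P c r).
Proof. by apply: (iffP forallP) => H c'; apply/implyP/H. Qed.

Lemma columnsP P c : reflect (exists r, (c, r) \in P) (c \in columns P).
Proof.
apply: (iffP imsetP) => [[[c' r] Pc /= ->]|[r Pr]]; first by exists r.
by exists (c, r).
Qed.

Lemma occursP R S P : reflect
  (exists x y r c, [/\ x \in P, y \in P,
    [/\ x.1 < y.1, x.1 < c, x.2 < y.2 & r < y.2],
    row_left P x.1 r /\ col_above P c y.2 & R x.2 r /\ S y.1 c])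
  (occurs R S P).
Proof.
apply: (iffP exists_inP) => [[x Px] /exists_inP[y Py]|].
  case/existsP=> r /existsP[c] /and5P[? ? ? ? /and4P[*]].
  by exists x, y, r, c.
case=> x [y] [r] [c] [Px Py [? ? ? ?] [? ?] [? ?]]; exists x => //.
apply/exists_inP; exists y => //; apply/existsP; exists r; apply/existsP.
by exists c; apply/and5P; split=> //; apply/and4P.
Qed.

Lemma eq_occurs R R' S S' P :
  R =2 R' -> S =2 S' -> occurs R S P = occurs R' S' P.
Proof.
by move=> eqR eqS; apply/occursP/occursP => -[x [y [r [c]]]];
   rewrite ?eqR ?eqS => H; exists x, y, r, c; rewrite ?eqR ?eqS.
Qed.

Lemma eq_avoiders R R' S S' k :
  R =2 R' -> S =2 S' -> avoiders R S k = avoiders R' S' k.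
Proof.
by move=> eqR eqS; apply/setP => P; rewrite !inE (eq_occurs P eqR eqS).
Qed.

(** * White cells *)

Lemma whiteP S P x : reflect
  (exists y c, [/\ y \in P, x.1 < y.1, x.1 < c, x.2 < y.2 &
     col_above P c y.2 /\ S y.1 c]) (x \in white S P).
Proof.
rewrite inE; apply: (iffP exists_inP) => [[y Py /existsP[c /and5P[*]]]|].
  by exists y, c.
case=> y [c] [Py ? ? ? [? ?]]; exists y => //; apply/existsP.
by exists c; apply/and5P.
Qed.

Lemma white_down S P x y :
  y.1 <= x.1 -> y.2 <= x.2 -> x \in white S P -> y \in white S P.
Proof.
move=> le1 le2 /whiteP[z [c] [Pz ? ? ? ?]]; apply/whiteP.
by exists z, c; split=> //; lia.
Qed.

(** The two lower terms may be tested in one column, that of [x]. Whichever of the cells [x] and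
    [(x.1, r)] is higher, a witness of its whiteness serves the other one as well. *)
Lemma occurs_white R S P : reflect
  (exists x r, [/\ x \in P, x \in white S P, (x.1, r) \in white S P,
     row_left P x.1 r & R x.2 r]) (occurs R S P).
Proof.
apply: (iffP (occursP _ _ _)).
  case=> x [y] [r] [c] [Px Py [? ? ? ?] [? ?] [? ?]].
  by exists x, r; split=> //; apply/whiteP; exists y, c.
case=> x [r] [Px /whiteP[y [c] [Py ? ? ? [? ?]]]].
case/whiteP=> z [d] [Pz ? ? ? [? ?]] ? ?.
have [le|lt] := leqP x.2 r.
  by exists x, z, r, d; split=> //; split=> //; simpl in *; lia.
by exists x, y, r, c; split=> //; split=> //; simpl in *; lia.
Qed.

(* Pushing a witness of whiteness to the north-east makes it avoid the white cells, so it
   survives any change of the white points. *)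
Lemma white_sub S P Q : partial_perm Q -> P :\: white S P \subset Q ->
  columns Q \subset columns P -> white S P \subset white S Q.
Proof.
move=> /partial_permP ppQ /subsetP subQ /subsetP cQ; apply/subsetP.
(* The induction runs from the rightmost column to the left, since a witness lies strictly to the
   right of its cell. *)
suff H m x : n - x.1 <= m -> x \in white S P -> x \in white S Q.
  by move=> x; apply: (H (n - x.1)).
elim: m x => [|m IH] x lem; first by have := ltn_ord x.1; lia.
move=> /whiteP[y [c] [Py ? ? ? [/col_aboveP ab Sc]]].
have [Wy|nWy] := boolP (y \in white S P).
  have /whiteP[z [d] [Qz ? ? ? ?]]: y \in white S Q by apply: IH => //; lia.
  by apply/whiteP; exists z, d; split=> //; lia.
(* A white point of [P] in column [c] is white for [Q] by induction; it lies above [y], so its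
   witness serves [x]. *)
have [/existsP[r /andP[Pr Wr]]|/existsPn nW] :=
    boolP [exists r, ((c, r) \in P) && ((c, r) \in white S P)].
  have /whiteP[z [d] [Qz ? ? ? ?]]: (c, r) \in white S Q by apply: IH => //=; lia.
  have ltr := ab _ Pr; apply/whiteP; exists z, d; split=> //; simpl in *; lia.
apply/whiteP; exists y, c; split=> //; first by apply: subQ; rewrite inE nWy.
(* A point of [Q] in column [c] must now be the non-white point of [P] there, which lies above
   [y]. *)
split=> //; apply/col_aboveP=> r Qr.
have /columnsP[r' Pr']: c \in columns P by apply/cQ/columnsP; exists r.
have := nW r'; rewrite Pr' /= => nWr'.
have Qr': (c, r') \in Q by apply: subQ; rewrite inE nWr'.
by case: (ppQ _ _ Qr Qr' (or_introl erefl)) => ->; apply: ab.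
Qed.

Lemma white_sup S P Q : partial_perm P ->
  Q :\: white S P \subset P -> columns P \subset columns Q ->
  white S Q \subset white S P.
Proof.
move=> /partial_permP ppP /subsetP subP /subsetP cP; apply/subsetP => x.
move=> /whiteP[y [c] [Qy ? ? ? [/col_aboveP ab Sc]]].
have [Wy|nWy] := boolP (y \in white S P).
  by apply: white_down Wy; lia.
have [/existsP[r /andP[Qr Wr]]|/existsPn nW] :=
    boolP [exists r, ((c, r) \in Q) && ((c, r) \in white S P)].
  by have ltr := ab _ Qr; apply: white_down Wr; simpl in *; lia.
apply/whiteP; exists y, c; split=> //; first by apply: subP; rewrite inE nWy.
split=> //; apply/col_aboveP=> r Pr.
have /columnsP[r' Qr']: c \in columns Q by apply/cP/columnsP; exists r.
have := nW r'; rewrite Qr' /= => nWr'.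
have Pr': (c, r') \in P by apply: subP; rewrite inE nWr'.
by case: (ppP _ _ Pr Pr' (or_introl erefl)) => ->; apply: ab.
Qed.

(** * An avoider is determined by its skeleton *)

Definition skeleton S P := (white S P, P :\: white S P, columns P).

(** A point of [P] in row [r'] to the right of column [c] would belong to [Q] and share its row with
    [(c, r')]. Hence row [r'] of [P] is empty or occupied to the left of [c], and can hold the
    leftmost term. *)
Lemma skeleton_occurs R S P Q c r r' : partial_perm P -> partial_perm Q ->
  (forall x, c < x.1 -> x \in P -> x \in Q) ->
  (c, r) \in P -> (c, r') \in Q -> (c, r) \in white S P ->
  (c, r') \in white S P -> r != r' -> R r r' -> occurs R S P.
Proof.
move=> /partial_permP ppP /partial_permP ppQ sub Pr Qr' Wr Wr' ne Rr.
apply/occurs_white; exists (c, r), r'; split=> //=.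
apply/row_leftP=> d Pd; case: (ltngtP d c) => // [lt|/val_inj eq].
  have [eq] := ppQ _ _ Qr' (sub (d, r') lt Pd) (or_intror erefl).
  by rewrite eq ltnn in lt.
have [eq'] := ppP _ _ Pr (eq_ind d (fun c => (c, r') \in P) Pd _ eq) (or_introl erefl).
by rewrite eq' eqxx in ne.
Qed.

(** In the rightmost column where [P] and [Q] differ, both have a white point, in different rows.
    According to the order of these rows under [R], one of [P] and [Q] has an occurrence. *)
Lemma skeleton_inj R S P Q :
  (forall r r', r != r' -> R r r' || R r' r) ->
  partial_perm P -> partial_perm Q -> ~~ occurs R S P -> ~~ occurs R S Q ->
  skeleton S P = skeleton S Q -> P = Q.
Proof.
move=> Rtot pP pQ oP oQ E; apply/setP => x0.
suff H m x : n - x.1 <= m -> (x \in P) = (x \in Q) by apply: (H (n - x0.1)).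
elim: m x {x0} => [|m IH] x lem; first by have := ltn_ord x.1; lia.
have gt y : x.1 < y.1 -> (y \in P) = (y \in Q) by move=> lt; apply: IH; lia.
have step A B : partial_perm A -> partial_perm B -> ~~ occurs R S A ->
    ~~ occurs R S B -> skeleton S A = skeleton S B ->
    (forall y, x.1 < y.1 -> (y \in A) = (y \in B)) -> x \in A -> x \in B.
  move: x {lem gt} => [c r] /= pA pB oA oB [EW ED EC] gt Ar.
  have memB z : z \notin white S A -> (z \in A) = (z \in B).
    by move=> nW; move/setP: ED => /(_ z); rewrite !in_setD -EW nW.
  have [Wr|nWr] := boolP ((c, r) \in white S A); last by rewrite -memB.
  have /columnsP[r' Br']: c \in columns B by rewrite -EC; apply/columnsP; exists r.
  have [Wr'|nWr'] := boolP ((c, r') \in white S A); last first.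
    move/partial_permP: pA => ppA.
    by move: (Br'); rewrite -memB // => /(ppA _ _ Ar)/(_ (or_introl erefl)) ->.
  have [->//|ne] := eqVneq r r'; case/orP: (Rtot _ _ ne) => Rr.
    case/negP: oA; apply: (@skeleton_occurs R S A B c r r') => // y lt.
    by rewrite gt.
  case/negP: oB; apply: (@skeleton_occurs R S B A c r' r) => //; try by rewrite -EW.
    by move=> y lt; rewrite gt.
  by rewrite eq_sym.
apply/idP/idP; first exact: step gt.
by apply: step => // y lt; rewrite gt.
Qed.

(** * Exchanging two rows within a skeleton *)

Lemma swap_rows_partial r r' P :
  partial_perm P -> partial_perm (swap_rows r r' P).
Proof.
move=> /partial_permP ppP; apply/partial_permP => -[c a] [d b]; rewrite !inE /=.
move=> Pa Pb E; suff [-> /perm_inj ->] : (c, tperm r r' a) = (d, tperm r r' b) by [].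
by apply: ppP => //; case: E => -> /=; [left|right].
Qed.

Lemma swap_rowsE r r' P :
  swap_rows r r' P = [set (x.1, tperm r r' x.2) | x in P].
Proof.
apply/setP => -[c a]; rewrite inE /=; apply/idP/imsetP => [Pa|[[d b] Pb [-> ->]]].
  by exists (c, tperm r r' a); rewrite //= tpermK.
by rewrite /= tpermK.
Qed.

Lemma swap_rows_inj r r' : injective (fun x => (x.1, tperm r r' x.2)).
Proof. by move=> [c a] [d b] [-> /perm_inj ->]. Qed.

Lemma card_swap_rows r r' P : #|swap_rows r r' P| = #|P|.
Proof. by rewrite swap_rowsE card_imset //; apply: swap_rows_inj. Qed.

Lemma columns_swap_rows r r' P : columns (swap_rows r r' P) = columns P.
Proof.
apply/setP => c; apply/columnsP/columnsP => -[a].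
  by rewrite inE /=; exists (tperm r r' a).
by exists (tperm r r' a); rewrite inE /= tpermK.
Qed.

(** The exchange moves [(c, r)] to [(c, r')] and possibly a point further left from row [r'] to row
    [r]. All these cells are white, as white cells are closed to the south-west, so the non-white
    points and the occupied columns stay, and with them the white cells. *)
Lemma swap_rows_skeleton S P c r r' :
  partial_perm P -> (c, r) \in P -> (c, r) \in white S P ->
  (c, r') \in white S P -> row_left P c r' ->
  skeleton S (swap_rows r r' P) = skeleton S P.
Proof.
move=> pP Pr Wr Wr' /row_leftP left; have /partial_permP ppP := pP.
set Q := swap_rows r r' P.
have pQ : partial_perm Q by apply: swap_rows_partial.
have EC : columns Q = columns P by apply: columns_swap_rows.
have ED : Q :\: white S P = P :\: white S P.
  apply/setP => -[d a]; rewrite in_setD [RHS]in_setD.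
  have [//|nW /=] := boolP ((d, a) \in white S P).
  rewrite inE /=; case: tpermP => [eq|eq|//]; rewrite {a}eq in nW *.
    have -> : (d, r) \in P = false.
      by apply: contraNF nW => /(ppP _ _ Pr)/(_ (or_intror erefl)) <-.
    apply: contraNF nW => /left lt.
    by apply: white_down Wr => //=; apply: ltnW.
  have -> : (d, r') \in P = false.
    by apply: contraNF nW => /left lt; apply: white_down Wr' => //=; apply: ltnW.
  by apply: contraNF nW => /(ppP _ _ Pr)/(_ (or_intror erefl)) [<-].
have EW : white S Q = white S P.
  apply/eqP; rewrite eqEsubset white_sup ?white_sub ?EC // ?ED //.
    by rewrite -ED subsetDl.
  by rewrite subsetDl.
by rewrite /skeleton EW ED EC.
Qed.

(* Exchanging two terms of an occurrence increases the weight, so a partial permutation of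
   maximal weight with a given skeleton is an avoider. *)
Definition weight (h : 'I_n -> nat) P := \sum_(x in P) x.1.+1 * h x.2.

Lemma rearrangement a b u v : a < b -> u < v ->
  b.+1 * u + a.+1 * v < b.+1 * v + a.+1 * u.
Proof. by move=> /subnKC <- /subnKC <-; nia. Qed.

Lemma weight_swap_rows h P c r r' :
  partial_perm P -> (c, r) \in P -> row_left P c r' -> h r < h r' ->
  weight h P < weight h (swap_rows r r' P).
Proof.
move=> /partial_permP ppP Pr /row_leftP left lt.
rewrite /weight swap_rowsE big_imset /=; last by move=> x y _ _; apply: swap_rows_inj.
have rest (A : {set cell}) : (forall x, x \in A -> x.2 <> r /\ x.2 <> r') ->
    \sum_(x in A) x.1.+1 * h (tperm r r' x.2) = \sum_(x in A) x.1.+1 * h x.2.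
  by move=> H; apply: eq_bigr => x /H[? ?]; rewrite tpermD //; apply/eqP => /esym.
rewrite !(big_setD1 (c, r) Pr) /= tpermL.
have ne x : x \in P :\ (c, r) -> x.2 <> r.
  rewrite !inE => /andP[/eqP nx Px] eq; case: nx.
  by apply: ppP => //; right.
have [/existsP[d Pd]|/existsPn no] := boolP [exists d, (d, r') \in P].
  have ltd := left _ Pd.
  have P'd : (d, r') \in P :\ (c, r).
    by rewrite !inE Pd andbT; apply/eqP => -[eq _]; rewrite eq ltnn in ltd.
  rewrite !(big_setD1 (d, r') P'd) tpermR rest; last first.
    move=> x; rewrite in_setD1 => /andP[/eqP nx P'x]; split; first exact: ne.
    move=> eq; case: nx; apply: ppP => //; last by right.
    by case/setD1P: P'x.
  by rewrite [X in X < _]addnA [X in _ < X]addnA ltn_add2r; exact: rearrangement ltd lt.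
rewrite rest; last first.
  move=> x P'x; split; first exact: ne.
  by case/setD1P: P'x => _; case: x => a b Pb /= eq; rewrite eq in Pb; case/negP: (no a).
by rewrite ltn_add2r ltn_mul2l lt.
Qed.

Lemma skeleton_avoider (h : 'I_n -> nat) S P : partial_perm P ->
  exists2 Q, Q \in avoiders (fun r r' => h r < h r') S #|P| &
    skeleton S Q = skeleton S P.
Proof.
move=> pP; pose same Q :=
  [&& partial_perm Q, #|Q| == #|P| & skeleton S Q == skeleton S P].
have sameP : same P by rewrite /same pP !eqxx.
case: (@arg_maxnP _ P same (weight h) sameP) => Q /and3P[pQ cQ /eqP EQ] maxQ.
exists Q => //; rewrite inE pQ cQ andbT /=; apply/negP => /occurs_white.
case=> -[c r] [r'] /= [Qr Wr Wr' left lt].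
have := maxQ (swap_rows r r' Q); rewrite /same swap_rows_partial //=.
rewrite card_swap_rows cQ /= (@swap_rows_skeleton S Q c) // EQ eqxx => /(_ isT).
by rewrite /= leqNgt (@weight_swap_rows h Q c).
Qed.

(* Both sides count the skeletons of all partial permutations of size [k]. *)
Lemma card_avoiders_irrelevant (h1 h2 : 'I_n -> nat) S k :
  injective h1 -> injective h2 ->
  #|avoiders (fun r r' => h1 r < h1 r') S k| =
  #|avoiders (fun r r' => h2 r < h2 r') S k|.
Proof.
suff H (h : 'I_n -> nat) : injective h ->
    #|avoiders (fun r r' => h r < h r') S k| =
    #|skeleton S @: [set P : {set cell} | partial_perm P && (#|P| == k)]|.
  by move=> i1 i2; rewrite !H.
move=> inj_h; have <- : skeleton S @: avoiders (fun r r' => h r < h r') S k =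
    skeleton S @: [set P : {set cell} | partial_perm P && (#|P| == k)].
  apply/setP => K; apply/imsetP/imsetP => -[P].
    by rewrite inE => /and3P[pP _ cP] ->; exists P; rewrite // inE pP.
  rewrite inE => /andP[pP /eqP <-] ->.
  by have [Q avQ <-] := skeleton_avoider h S pP; exists Q.
rewrite card_in_imset // => P Q; rewrite !inE => /and3P[pP oP _] /and3P[pQ oQ _].
apply: skeleton_inj oP oQ => // r r' ne.
by rewrite -neq_ltn; apply: contra ne => /eqP/inj_h ->.
Qed.

(** * Reflection in the antidiagonal *)

Definition antitranspose P : {set cell} :=
  [set x : cell | (rev_ord x.2, rev_ord x.1) \in P].

Lemma antitransposeK : involutive antitranspose.
Proof. by move=> P; apply/setP => -[c r]; rewrite !inE /= !rev_ordK. Qed.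

Lemma antitranspose_partial P : partial_perm P -> partial_perm (antitranspose P).
Proof.
move=> /partial_permP ppP; apply/partial_permP => -[c a] [d b]; rewrite !inE /=.
move=> Pa Pb E.
suff eq : (rev_ord a, rev_ord c) = (rev_ord b, rev_ord d).
  by rewrite (rev_ord_inj (congr1 fst eq)) (rev_ord_inj (congr1 snd eq)).
by apply: ppP => //; case: E => -> /=; [right|left].
Qed.

Lemma card_antitranspose P : #|antitranspose P| = #|P|.
Proof.
pose f x : cell := (rev_ord x.2, rev_ord x.1).
have fK : involutive f by case=> c r; rewrite /f /= !rev_ordK.
have -> : antitranspose P = f @: P.
  apply/setP => x; rewrite inE -/(f x); apply/idP/imsetP => [Pf|[y Py ->]].
    by exists (f x); rewrite ?fK.
  by rewrite fK.
by rewrite card_imset //; apply: inv_inj.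
Qed.

Lemma row_left_antitranspose P c r :
  row_left (antitranspose P) c r = col_above P (rev_ord r) (rev_ord c).
Proof.
apply/row_leftP/col_aboveP => H a Pa.
  have := H (rev_ord a); rewrite inE /= rev_ordK => /(_ Pa).
  by have := ltn_ord c; have := ltn_ord a; lia.
have := H (rev_ord a); move: Pa; rewrite inE /= => Pa /(_ Pa).
by have := ltn_ord c; have := ltn_ord a; lia.
Qed.

Lemma col_above_antitranspose P c r :
  col_above (antitranspose P) c r = row_left P (rev_ord r) (rev_ord c).
Proof.
rewrite -[P in RHS]antitransposeK row_left_antitranspose.
by rewrite !rev_ordK.
Qed.

Definition rev_rel R : rel 'I_n := fun r r' => R (rev_ord r) (rev_ord r').

Lemma occurs_antitranspose R S P :
  occurs R S (antitranspose P) -> occurs (rev_rel S) (rev_rel R) P.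
Proof.
case/occursP=> -[c1 r1] [[c2 r2]] [r] [c]; rewrite !inE /=.
rewrite row_left_antitranspose col_above_antitranspose.
case=> Px Py [? ? ? ?] [? ?] [? ?]; apply/occursP.
(* The reflection reverses the north-east order: [x] and [y] change roles, and so do the row [r] and
   the column [c]. *)
exists (rev_ord r2, rev_ord c2), (rev_ord r1, rev_ord c1), (rev_ord c), (rev_ord r).
rewrite /rev_rel /= !rev_ordK; split=> //.
by have := ltn_ord c2; have := ltn_ord c; have := ltn_ord r2; split; lia.
Qed.

Lemma card_avoiders_antitranspose R S k :
  #|avoiders R S k| = #|avoiders (rev_rel S) (rev_rel R) k|.
Proof.
have H R1 S1 : #|avoiders (rev_rel S1) (rev_rel R1) k| <= #|avoiders R1 S1 k|.
  rewrite -(card_imset _ (inv_inj antitransposeK)) subset_leq_card //.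
  apply/subsetP => _ /imsetP[P avP ->]; move: avP.
  rewrite !inE card_antitranspose => /and3P[pP oP ->].
  rewrite antitranspose_partial //= andbT.
  exact: contra (@occurs_antitranspose _ _ _) oP.
(* The other inequality is [H] for the reversed relations, [rev_rel] being an involution. *)
apply/eqP; rewrite eqn_leq H andbT; apply: leq_trans (H _ _).
rewrite (@eq_avoiders _ R _ S) // => r r'; by rewrite /rev_rel !rev_ordK.
Qed.

Lemma card_avoiders_1234_2143 k :
  #|avoiders (fun r r' => r' < r) (fun c c' => c < c') k| =
  #|avoiders (fun r r' => r < r') (fun c c' => c' < c) k|.
Proof.
have rev_lt (a b : 'I_n) : (rev_ord a < rev_ord b) = (b < a).
  by have := ltn_ord a; have := ltn_ord b; simpl; lia.
have swapR S : #|avoiders (fun r r' => r' < r) S k| =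
    #|avoiders (fun r r' => r < r') S k|.
  rewrite -(@eq_avoiders (fun r r' => rev_ord r < rev_ord r') _ S S k rev_lt) //.
  exact: card_avoiders_irrelevant (inj_comp val_inj rev_ord_inj) val_inj.
(* Turn the lower pair over, reflect, and turn over the pair that has become the lower one. *)
rewrite swapR card_avoiders_antitranspose -swapR.
by congr #|pred_of_set _|; apply: eq_avoiders => r r'; apply: rev_lt.
Qed.
End Cells.

(** * The quadrant of a signed permutation *)

Lemma contains1234P m (s : {perm 'I_m}) : reflect
  (exists a b c d : 'I_m,
    [/\ a < b, b < c, c < d & [/\ s a < s b, s b < s c & s c < s d]])
  (contains1234 s).
Proof.
apply: (iffP idP) => [/existsP[a /existsP[b /existsP[c /existsP[d]]]]|].
  by case/and5P=> ? ? ? ? /andP[? ?]; exists a, b, c, d.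
case=> a [b] [c] [d] [? ? ? [? ? ?]].
apply/existsP; exists a; apply/existsP; exists b; apply/existsP; exists c.
by apply/existsP; exists d; apply/and5P; split=> //; apply/andP.
Qed.

Lemma contains2143P m (s : {perm 'I_m}) : reflect
  (exists a b c d : 'I_m,
    [/\ a < b, b < c, c < d & [/\ s b < s a, s a < s d & s d < s c]])
  (contains2143 s).
Proof.
apply: (iffP idP) => [/existsP[a /existsP[b /existsP[c /existsP[d]]]]|].
  by case/and5P=> ? ? ? ? /andP[? ?]; exists a, b, c, d.
case=> a [b] [c] [d] [? ? ? [? ? ?]].
apply/existsP; exists a; apply/existsP; exists b; apply/existsP; exists c.
by apply/existsP; exists d; apply/and5P; split=> //; apply/andP.
Qed.

Section SignedPermutations.
Variable n : nat.
Implicit Types (s : {perm 'I_(n + n)}) (p q : 'I_(n + n)).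
Implicit Types (P : {set 'I_n * 'I_n}).

(* Column [c] is the position [c + 1], row [r] the value [r - n]. *)
Definition quadrant s : {set 'I_n * 'I_n} :=
  [set x : 'I_n * 'I_n | s (rshift n x.1) == lshift n x.2].

(** The height [h] treats both patterns at once: it is [rev_ord] for 1234, where these entries
    decrease, and [val] for 2143, where they increase. *)
Definition monotone_positives (h : 'I_(n + n) -> nat) s :=
  [forall p : 'I_(n + n), forall q : 'I_(n + n),
    [&& n <= p, p < q, n <= s p & n <= s q] ==> (h (s p) < h (s q))].

Lemma signed_permP s :
  reflect (forall p, s (rev_ord p) = rev_ord (s p)) (signed_perm s).
Proof. by apply: (iffP forallP) => H p; apply/eqP/H. Qed.

Lemma monotone_positivesP h s : reflect
  (forall p q, n <= p -> p < q -> n <= s p -> n <= s q -> h (s p) < h (s q))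
  (monotone_positives h s).
Proof.
apply: (iffP forallP) => [H p q ? ? ? ?|H p].
  by have /forallP/(_ q)/implyP := H p; apply; apply/and4P.
by apply/forallP => q; apply/implyP => /and4P[]; apply: H.
Qed.

Lemma ord_left p : p < n -> exists c : 'I_n, p = lshift n c.
Proof. by move=> lt; exists (Ordinal lt); apply: val_inj. Qed.

Lemma ord_right p : n <= p -> exists c : 'I_n, p = rshift n c.
Proof.
move=> le; have lt : p - n < n by have := ltn_ord p; lia.
by exists (Ordinal lt); apply: val_inj => /=; lia.
Qed.

(** The value of an empty row is taken at a negative position, to the left of the whole quadrant,
    and an empty column carries a positive value, above it. So [row_left] and [col_above] merely say
    [a < b] and [s c < s d]. *)
Lemma occurs_quadrantP (Tr Tc : rel nat) s : reflect
  (exists a b c d : 'I_(n + n), [/\ n <= b, s c < n,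
    [/\ a < b, b < c, b < d & s b < s c], s a < s c /\ s c < s d
    & Tr (s b) (s a) /\ Tc c d])
  (occurs (fun r r' : 'I_n => Tr r r')
          (fun c c' : 'I_n => Tc (n + c) (n + c')) (quadrant s)).
Proof.
apply: (iffP (occursP _ _ _)).
  case=> -[c1 r1] [[c2 r2]] [r] [c]; rewrite !inE /=.
  case=> /eqP s1 /eqP s2 [? ? ? ?] [/row_leftP left /col_aboveP above] [? ?].
  have sr : s ((s^-1)%g (lshift n r)) = lshift n r by rewrite permKV.
  exists ((s^-1)%g (lshift n r)), (rshift n c1), (rshift n c2), (rshift n c).
  rewrite sr s1 s2 /= leq_addr ltn_ord !ltn_add2l; split=> //; split=> //.
    rewrite ltnNge; apply/negP => le.
    have [c' eq] : exists c', (s^-1)%g (lshift n r) = rshift n c'.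
      by apply: ord_right; lia.
    have : c' < c1 by apply: left; rewrite inE /= -eq sr.
    by move: le; rewrite eq /=; lia.
  rewrite ltnNge; apply/negP => le.
  have [r' eq] : exists r', s (rshift n c) = lshift n r'.
    by apply: ord_left; have := ltn_ord r2; lia.
  have : r2 < r' by apply: above; rewrite inE /= eq.
  by move: le; rewrite eq /=; lia.
case=> a [b] [c] [d] [nb cn [ab bc bd sbc] [sac scd] [Trab Tccd]].
have [c1 b1] := ord_right nb; have [c2 c2E] := ord_right (leq_trans nb (ltnW bc)).
have [c3 d3] := ord_right (leq_trans nb (ltnW bd)).
have [r1 r1E] := ord_left (ltn_trans sbc cn); have [r2 r2E] := ord_left cn.
have [r3 r3E] := ord_left (ltn_trans sac cn).
exists (c1, r1), (c2, r2), r3, c3; rewrite !inE /= -b1 -c2E r1E r2E.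
move: Trab Tccd sac sbc scd; rewrite r1E r2E r3E c2E d3 /= => ? ? ? ? scd.
split=> //; first by move: bc bd; rewrite b1 c2E d3 /= !ltn_add2l.
split.
  apply/row_leftP => c'; rewrite inE /= => /eqP; rewrite -r3E => /perm_inj eq.
  by move: ab; rewrite -eq b1 /= ltn_add2l.
apply/col_aboveP => r'; rewrite inE /= => /eqP eq.
by move: scd; rewrite eq.
Qed.

(** * The two patterns read off the quadrant *)

Lemma occurs_1234_quadrantP s : reflect
  (exists a b c d : 'I_(n + n), [/\ a < b, b < c, c < d &
     [/\ s a < s b, s b < s c & s c < s d] /\ n <= b /\ s c < n])
  (occurs (fun r r' : 'I_n => r' < r) (fun c c' : 'I_n => c < c') (quadrant s)).
Proof.
rewrite (@eq_occurs _ _ (fun r r' : 'I_n => gtn r r') _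
  (fun c c' : 'I_n => ltn (n + c) (n + c'))) //; last first.
  by move=> c c' /=; rewrite ltn_add2l.
apply: (iffP (occurs_quadrantP gtn ltn s)) => -[a [b [c [d]]]].
  by case=> ? ? [? ? ? ?] [? ?] [? ?]; exists a, b, c, d.
case=> ab bc cd [[sab sbc scd] [nb cn]]; exists a, b, c, d; split=> //.
  by split=> //; lia.
by split=> //; lia.
Qed.

Lemma occurs_2143_quadrantP s : reflect
  (exists a b c d : 'I_(n + n), [/\ a < b, b < c, c < d &
     [/\ s b < s a, s a < s d & s d < s c] /\ n <= b /\ s d < n])
  (occurs (fun r r' : 'I_n => r < r') (fun c c' : 'I_n => c' < c) (quadrant s)).
Proof.
rewrite (@eq_occurs _ _ (fun r r' : 'I_n => ltn r r') _
  (fun c c' : 'I_n => gtn (n + c) (n + c'))) //; last first.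
  by move=> c c' /=; rewrite ltn_add2l.
(* In 2143 the second term from the top is the last one, so [c] and [d] change places. *)
apply: (iffP (occurs_quadrantP ltn gtn s)) => -[a [b [c [d]]]].
  by case=> ? ? [? ? ? ?] [? ?] [? ?]; exists a, b, d, c.
case=> ab bc cd [[sba sad sdc] [nb dn]]; exists a, b, d, c; split=> //.
by split=> //; lia.
Qed.

(** Negation reverses positions and values alike, so it carries decreasing pairs to decreasing
    pairs. *)
Lemma decreasing_negatives s p q :
  signed_perm s -> monotone_positives (fun v => rev_ord v) s ->
  p < q -> q < n -> s p < n -> s q < n -> s q < s p.
Proof.
move=> /signed_permP sg /monotone_positivesP mono ? ? ? ?.
have := mono (rev_ord q) (rev_ord p); rewrite !sg /=.
by have [[[? ?] ?] ?] := (ltn_ord p, ltn_ord q, ltn_ord (s p), ltn_ord (s q)); lia.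
Qed.

Lemma increasing_negatives s p q :
  signed_perm s -> monotone_positives val s ->
  p < q -> q < n -> s p < n -> s q < n -> s p < s q.
Proof.
move=> /signed_permP sg /monotone_positivesP mono ? ? ? ?.
have := mono (rev_ord q) (rev_ord p); rewrite !sg /=.
by have [[[? ?] ?] ?] := (ltn_ord p, ltn_ord q, ltn_ord (s p), ltn_ord (s q)); lia.
Qed.

(* A pattern invariant under reversal and complementation also occurs at the negated
   positions, so an occurrence may be assumed to meet the quadrant. *)
Lemma avoid1234E s : signed_perm s ->
  ~~ contains1234 s = monotone_positives (fun v => rev_ord v) s &&
    ~~ occurs (fun r r' : 'I_n => r' < r) (fun c c' : 'I_n => c < c') (quadrant s).
Proof.
move=> sg; have /signed_permP rv := sg.
apply/idP/andP => [nc|[mono]].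
  split; last first.
    apply: contra nc => /occurs_1234_quadrantP[a [b [c [d [? ? ? [? _]]]]]].
    by apply/contains1234P; exists a, b, c, d.
  apply/monotone_positivesP => p q np pq nsp nsq.
  have : s q != s p by apply: contraL pq => /eqP/perm_inj ->; rewrite ltnn.
  rewrite -val_eqE neq_ltn => /orP[lt|lt].
    by have [? ?] := (ltn_ord (s p), ltn_ord (s q)); move: lt; simpl; lia.
  case/negP: nc; apply/contains1234P.
  exists (rev_ord q), (rev_ord p), p, q; rewrite !rv /=.
  have [[[? ?] ?] ?] := (ltn_ord p, ltn_ord q, ltn_ord (s p), ltn_ord (s q)).
  by move: lt; simpl; split; [| | | split]; lia.
apply: contra => /contains1234P[a [b [c [d [ab bc cd [sab sbc scd]]]]]].
have [[[[[[[? ?] ?] ?] ?] ?] ?] ?] := (ltn_ord a, ltn_ord b, ltn_ord c, ltn_ord d,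
             ltn_ord (s a), ltn_ord (s b), ltn_ord (s c), ltn_ord (s d)).
have neg := decreasing_negatives sg mono.
have /monotone_positivesP pos := mono.
apply/occurs_1234_quadrantP.
(* If [b] is negative, then [s b] is positive by [neg], hence [s c] and [s d] too, and [c] is
   negative by [pos]; the negated occurrence meets the quadrant. *)
have [nb|bn] := leqP n b; last first.
  have nsb : n <= s b by rewrite leqNgt; apply/negP => ?; have := neg a b; lia.
  have cn : c < n.
    by rewrite ltnNge; apply/negP => ?; have := pos c d; simpl; lia.
  exists (rev_ord d), (rev_ord c), (rev_ord b), (rev_ord a); rewrite !rv /=.
  by split; [| | | split; [split|]]; lia.
exists a, b, c, d; do 3!split=> //.
by rewrite ltnNge; apply/negP => ?; have := pos c d; simpl; lia.
Qed.

Lemma avoid2143E s : signed_perm s ->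
  ~~ contains2143 s = monotone_positives val s &&
    ~~ occurs (fun r r' : 'I_n => r < r') (fun c c' : 'I_n => c' < c) (quadrant s).
Proof.
move=> sg; have /signed_permP rv := sg.
apply/idP/andP => [nc|[mono]].
  split; last first.
    apply: contra nc => /occurs_2143_quadrantP[a [b [c [d [? ? ? [? _]]]]]].
    by apply/contains2143P; exists a, b, c, d.
  apply/monotone_positivesP => p q np pq nsp nsq.
  have : s p != s q by apply: contraL pq => /eqP/perm_inj ->; rewrite ltnn.
  rewrite -val_eqE neq_ltn => /orP[//|lt].
  case/negP: nc; apply/contains2143P.
  exists (rev_ord q), (rev_ord p), p, q; rewrite !rv /=.
  have [[[? ?] ?] ?] := (ltn_ord p, ltn_ord q, ltn_ord (s p), ltn_ord (s q)).
  by move: lt; simpl; split; [| | | split]; lia.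
apply: contra => /contains2143P[a [b [c [d [ab bc cd [sba sad sdc]]]]]].
have [[[[[[[? ?] ?] ?] ?] ?] ?] ?] := (ltn_ord a, ltn_ord b, ltn_ord c, ltn_ord d,
             ltn_ord (s a), ltn_ord (s b), ltn_ord (s c), ltn_ord (s d)).
have neg := increasing_negatives sg mono.
have /monotone_positivesP pos := mono.
apply/occurs_2143_quadrantP.
(* If [s d] is positive, so is [s c], hence [c] is negative by [pos] and [s a] positive by [neg];
   again the occurrence is negated. *)
have [nd|dn] := leqP n (s d).
  have cn : c < n.
    by rewrite ltnNge; apply/negP => ?; have := pos c d; simpl; lia.
  have nsa : n <= s a by rewrite leqNgt; apply/negP => ?; have := neg a b; lia.
  exists (rev_ord d), (rev_ord c), (rev_ord b), (rev_ord a); rewrite !rv /=.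
  by split; [| | | split; [split|]]; lia.
exists a, b, c, d; do 3!split=> //.
by rewrite leqNgt; apply/negP => ?; have := neg a b; lia.
Qed.

(** * The quadrant map is a bijection *)

Lemma quadrant_partial s : partial_perm (quadrant s).
Proof.
apply/partial_permP => -[c r] [d t]; rewrite !inE /= => /eqP sc /eqP sd.
case=> /= eq; first by move: sc; rewrite eq sd => /lshift_inj ->.
by move: sc; rewrite eq -sd => /perm_inj/rshift_inj ->.
Qed.

Lemma card_quadrant s : #|quadrant s| + npos s = n.
Proof.
have cardR : #|@rshift n n @: [set: 'I_n]| = n.
  by rewrite card_imset ?cardsT ?card_ord //; apply: rshift_inj.
apply: etrans cardR.
rewrite -(cardsID [set p : 'I_(n + n) | n <= s p]) addnC /npos; congr (_ + _).
  apply: eq_card => p; rewrite !inE; congr (_ && _).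
  apply/idP/imsetP => [/ord_right[c ->]|[c _ ->]]; first by exists c.
  exact: leq_addr.
have /card_in_imset <- : {in quadrant s &, injective (fun x => @rshift n n x.1)}.
  move=> x y Px Py /rshift_inj eq.
  by have /partial_permP := quadrant_partial s; apply=> //; left.
apply: eq_card => p; rewrite !inE -ltnNge; apply/imsetP/andP.
  case=> -[c r]; rewrite inE /= => /eqP sc ->; rewrite sc /= ltn_ord.
  by rewrite imset_f ?inE.
case=> lt /imsetP[c _ eq]; have [r sc] := ord_left lt.
by exists (c, r) => //; rewrite inE /= -eq sc.
Qed.

(** The value [s1 p] is taken by [s2] at a positive position, and not before [p], where both agree;
    monotonicity of [s2] does the rest. *)
Lemma monotone_le h s1 s2 p :
  signed_perm s1 -> signed_perm s2 -> quadrant s1 = quadrant s2 ->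
  monotone_positives h s2 -> n <= p -> n <= s1 p -> n <= s2 p ->
  (forall q, n <= q -> q < p -> s1 q = s2 q) -> h (s2 p) <= h (s1 p).
Proof.
move=> /signed_permP rv1 /signed_permP rv2 E /monotone_positivesP mono np n1 n2 IH.
pose q := (s2^-1)%g (s1 p); have s2q : s2 q = s1 p by rewrite permKV.
(* Otherwise the negative of [q] is a column of the common quadrant, at which [s1] takes the
   negative of [s1 p]; this forces [q = p]. *)
have nq : n <= q.
  rewrite leqNgt; apply/negP => qn.
  have [c eqc] : exists c, rev_ord q = rshift n c.
    by apply: ord_right; have := ltn_ord q; simpl; lia.
  have [r eqr] : exists r, rev_ord (s1 p) = lshift n r.
    by apply: ord_left; have := ltn_ord (s1 p); simpl; lia.
  have : (c, r) \in quadrant s1 by rewrite E inE /= -eqc rv2 s2q eqr.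
  rewrite inE /= -eqc -eqr rv1 => /eqP/rev_ord_inj/perm_inj eq.
  by rewrite -eq leqNgt qn in np.
case: (ltngtP q p) => [lt|gt|/val_inj eq].
- by have := IH q nq lt; rewrite s2q => /perm_inj eq; rewrite eq ltnn in lt.
- by rewrite -s2q; apply/ltnW/mono; rewrite // s2q.
- by rewrite -s2q eq.
Qed.

Lemma quadrant_inj h s1 s2 : injective h ->
  signed_perm s1 -> signed_perm s2 ->
  monotone_positives h s1 -> monotone_positives h s2 ->
  quadrant s1 = quadrant s2 -> s1 = s2.
Proof.
move=> inj_h sg1 sg2 m1 m2 E.
suff right m p : p < m -> n <= p -> s1 p = s2 p.
  apply/permP => p; have [/right|lt] := leqP n p; first by apply; apply: ltnSn.
  have /signed_permP rv1 := sg1; have /signed_permP rv2 := sg2.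
  apply: rev_ord_inj; rewrite -rv1 -rv2; apply: right (ltnSn _) _ => /=.
  by have := ltn_ord p; lia.
elim: m p => // m IH p lepm np.
have IHp q : n <= q -> q < p -> s1 q = s2 q.
  by move=> nq qp; apply: IH => //; apply: leq_trans qp lepm.
have [c pc] := ord_right np.
have [lt1|ge1] := ltnP (s1 p) n.
  have [r s1r] := ord_left lt1.
  have : (c, r) \in quadrant s2 by rewrite -E inE /= -pc s1r.
  by rewrite inE /= -pc s1r => /eqP ->.
have [lt2|ge2] := ltnP (s2 p) n.
  have [r s2r] := ord_left lt2.
  have : (c, r) \in quadrant s1 by rewrite E inE /= -pc s2r.
  by rewrite inE /= -pc s2r => /eqP ->.
apply/inj_h/eqP; rewrite eqn_leq (@monotone_le h s2 s1) //=.
  by rewrite (@monotone_le h s1 s2).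
by move=> q nq qp; rewrite IHp.
Qed.

Lemma rev_lshift (c : 'I_n) : rev_ord (lshift n c) = rshift n (rev_ord c).
Proof. by apply: val_inj => /=; have := ltn_ord c; lia. Qed.

(** The empty columns, from left to right, receive the negatives of the empty rows' values in the
    order of [h]; negative positions follow by oddness. *)
Lemma quadrant_surj (h : 'I_(n + n) -> nat) P : injective h -> partial_perm P ->
  exists s, [/\ signed_perm s, monotone_positives h s & quadrant s = P].
Proof.
move=> inj_h pP; have /partial_permP ppP := pP.
pose rows : {set 'I_n} := [set x.2 | x in P].
pose v (r : 'I_n) : 'I_(n + n) := rev_ord (lshift n r).
have v_ge r : n <= v r by rewrite /v rev_lshift leq_addr.
have v_inj : injective v by move=> r r' /rev_ord_inj/lshift_inj.
pose leC (c d : 'I_n) := c <= d; pose leR r r' := h (v r) <= h (v r').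
pose C := sort leC (enum (~: columns P)); pose L := sort leR (enum (~: rows)).
have memC c : (c \in C) = (c \notin columns P) by rewrite mem_sort mem_enum inE.
have memL r : (r \in L) = (r \notin rows) by rewrite mem_sort mem_enum inE.
have uL : uniq L by rewrite sort_uniq enum_uniq.
have szCL : size L = size C.
  rewrite !size_sort -!cardE; apply/eqP; rewrite -(eqn_add2l #|columns P|) cardsC.
  suff -> : #|columns P| = #|rows| by rewrite cardsC.
  rewrite !card_in_imset // => x y Px Py eq; apply: ppP => //; by [left | right].
have sC : sorted leC C by apply: sort_sorted => c d; apply: leq_total.
have sL : sorted leR L by apply: sort_sorted => c d; apply: leq_total.
have idx c : c \in C -> index c C < size L by rewrite szCL index_mem.
(* The row of the point in column [c], or the empty row of the same rank if the column is empty. The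
   default [c] of [nth] is never reached there, by [idx]. *)
pose g c := odflt (nth c L (index c C)) [pick r | (c, r) \in P].
have gP c r : (c, r) \in P -> g c = r.
  rewrite /g => Pr; case: pickP => [r' /= Pr'|/(_ r)]; last by rewrite Pr.
  by have [] := ppP _ _ Pr Pr' (or_introl erefl).
have gC c : c \in C -> g c = nth c L (index c C).
  rewrite memC /g => nc; case: pickP => // r Pr; case/negP: nc.
  by apply/columnsP; exists r.
have g_rows c : (g c \in rows) = (c \in columns P).
  have [/columnsP[r Pr]|nc] := boolP (c \in columns P).
    by rewrite (gP _ _ Pr); apply/imsetP; exists (c, r).
  apply/negbTE; rewrite -memL gC ?memC // mem_nth // idx ?memC //.
have g_inj : injective g.
  move=> c d eq; have := g_rows c; rewrite eq g_rows => eqcol.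
  have [/columnsP[r Pr]|nc] := boolP (c \in columns P).
    have /columnsP[t Pt] : d \in columns P by rewrite eqcol; apply/columnsP; exists r.
    move: eq; rewrite (gP _ _ Pr) (gP _ _ Pt) => eq.
    by have [] := ppP _ _ Pr Pt (or_intror eq).
  have [Cc Cd] : c \in C /\ d \in C by rewrite !memC eqcol.
  apply/(index_inj c Cc Cd)/eqP; rewrite -(nth_uniq c _ _ uL) ?idx // -gC // eq gC //.
  by apply/eqP/set_nth_default/idx.
pose f c := if c \in columns P then lshift n (g c) else v (g c).
have f_lt c : (f c < n) = (c \in columns P).
  by rewrite /f; case: ifP => _ /=; rewrite ?ltn_ord // ltnNge v_ge.
(* Distinct columns receive distinct absolute values; this is what makes the odd extension [F]
   injective. *)
have f_inj_sign c d : f c = f d \/ f c = rev_ord (f d) -> c = d.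
  move=> E; apply: g_inj; have := f_lt c; have := f_lt d; move: E; rewrite /f.
  by do 2![case: ifP => _]; case; rewrite /v ?rev_ordK;
     try (by move/lshift_inj); try (by move/rev_ord_inj/lshift_inj);
     rewrite ?rev_lshift; move/(congr1 val) => /=;
     have := ltn_ord (g c); have := ltn_ord (g d); lia.
have f_inj : injective f by move=> c d eq; apply: f_inj_sign; left.
have f_rev c d : f c <> rev_ord (f d).
  move=> eq; have eqcd : c = d by apply: f_inj_sign; right.
  by move/(congr1 val): eq => /=; rewrite eqcd; have := ltn_ord (f d); lia.
pose F p := match split p with inl c => rev_ord (f (rev_ord c)) | inr c => f c end.
have Fr c : F (rshift n c) = f c.
  by rewrite /F; case: split_ordP => d; [move/eqP; rewrite eq_rlshift | move/rshift_inj ->].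
have Fl c : F (lshift n c) = rev_ord (f (rev_ord c)).
  by rewrite /F; case: split_ordP => d; [move/lshift_inj -> | move/eqP; rewrite eq_lrshift].
have Frev p : F (rev_ord p) = rev_ord (F p).
  case: (split_ordP p) => c ->; first by rewrite rev_lshift Fr Fl rev_ordK.
  by rewrite -{1}(rev_ordK c) -rev_lshift rev_ordK Fl Fr rev_ordK.
have Finj : injective F.
  move=> p q; case: (split_ordP p) => c ->; case: (split_ordP q) => d ->;
    rewrite ?Fr ?Fl => E.
  - by rewrite (rev_ord_inj (f_inj _ _ (rev_ord_inj E))).
  - by have := f_rev _ _ (esym E).
  - by have := f_rev _ _ E.
  - by rewrite (f_inj c d).
exists (perm Finj); split.
- by apply/signed_permP => p; rewrite !permE.
- apply/monotone_positivesP => p q np pq; rewrite !permE.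
  have [c pc] := ord_right np; have [d qd] := ord_right (leq_trans np (ltnW pq)).
  rewrite pc qd !Fr [n <= f c]leqNgt [n <= f d]leqNgt !f_lt /f => nc nd.
  rewrite (negbTE nc) (negbTE nd).
  have lt_cd : c < d by move: pq; rewrite pc qd /= ltn_add2l.
  move: nc nd; rewrite -!memC => Cc Cd; rewrite !gC //.
  have lt_idx : index c C < index d C.
    rewrite ltnNge leq_eqVlt; apply/negP => /orP[/eqP/(index_inj c Cd Cc) eq|lt].
      by rewrite eq ltnn in lt_cd.
    have trC : transitive leC by move=> x y z; apply: leq_trans.
    have := sorted_ltn_index trC sC _ _ Cd Cc lt.
    by rewrite /leC leqNgt lt_cd.
  have trL : transitive leR by move=> x y z; apply: leq_trans.
  have := sorted_ltn_nth trL c sL _ _ (idx _ Cc) (idx _ Cd) lt_idx.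
  rewrite (@set_nth_default _ L c d) ?idx // /leR => le.
  rewrite ltn_neqAle le.
  rewrite andbT; apply/eqP => /inj_h/v_inj/eqP.
  by rewrite nth_uniq ?idx // ?ltn_eqF.
apply/setP => -[c r]; rewrite inE /= permE Fr; apply/eqP/idP.
  move=> E; have : c \in columns P by rewrite -f_lt E /= ltn_ord.
  move=> /columnsP[r' Pr']; move: E; rewrite /f ifT; last by apply/columnsP; exists r'.
  by rewrite (gP _ _ Pr') => /lshift_inj <-.
by move=> Pr; rewrite /f ifT ?(gP _ _ Pr) //; apply/columnsP; exists r.
Qed.
End SignedPermutations.

(** * Counting by the number of positive entries *)

Lemma card_signed_avoiders n j (h : 'I_(n + n) -> nat) (R S : rel 'I_n) :
  j <= n -> injective h ->
  #|[set s : {perm 'I_(n + n)} | [&& signed_perm s,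
      monotone_positives h s && ~~ occurs R S (quadrant s) & npos s == j]]| =
  #|avoiders R S (n - j)|.
Proof.
move=> le_jn inj_h.
have npos_card (s : {perm 'I_(n + n)}) : (npos s == j) = (#|quadrant s| == n - j).
  by have := card_quadrant s; lia.
rewrite -(card_in_imset (f := @quadrant n)).
  apply: eq_card => P; apply/imsetP/idP => [[s]|].
    rewrite inE npos_card => /and3P[sg /andP[mono oc] ns] ->.
    by rewrite inE quadrant_partial oc.
  rewrite inE => /and3P[pP oc cP]; have [s [sg mono E]] := quadrant_surj inj_h pP.
  by exists s; rewrite // inE npos_card E sg mono oc.
move=> s t; rewrite !inE => /and3P[sgs /andP[ms _] _] /and3P[sgt /andP[mt _] _].
exact: quadrant_inj inj_h sgs sgt ms mt.
Qed.

Theorem theorem1p1 (n j : nat) (hn : 1 <= n) (hj : j <= n) :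
  #|Bnj1234 n j| = #|Bnj2143 n j|.
Proof.
have inj_rev : injective (fun v : 'I_(n + n) => rev_ord v : nat).
  exact: inj_comp val_inj rev_ord_inj.
apply: etrans (etrans (card_avoiders_1234_2143 n (n - j)) _).
  rewrite -(card_signed_avoiders _ _ hj inj_rev); apply: eq_card => s; rewrite !inE.
  by have [/avoid1234E ->|] := boolP (signed_perm s).
rewrite -(card_signed_avoiders _ _ hj val_inj); apply: eq_card => s; rewrite !inE.
by have [/avoid2143E ->|] := boolP (signed_perm s).
Qed.
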